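(* There is an algorithm running in time $O(d^2)$ that, given a ranking $\pi\in\mathcal{S}_d$, a partition of $[d]$ into $g$ groups $G_1,\dots,G_g$, rational vectors $\bar{\alpha}=(\alpha_1,\dots,\alpha_g)\in[0,1]^g\cap\mathbb{Q}^g$, $\bar{\beta}=(\beta_1,\dots,\beta_g)\in[0,1]^g\cap\mathbb{Q}^g$, $k\in[d]$ and a block length $b\in\mathbb{Z}_+$, outputs a closest $(\bar{\alpha},\bar{\beta})$-block-$k$-fair ranking to $\pi$ under the Kendall tau distance.
   Context: $\mathcal{S}_d$ is the set of rankings (permutations) of $[d]$; a prefix of $\pi$ of length $m$ is $\{\pi(1),\dots,\pi(m)\}$. Kendall tau distance: $\mathcal{K}(\pi_1,\pi_2)=|\{(a,b)\in[d]^2: a \text{ before } b \text{ in }\pi_1,\ b\text{ before }a\text{ in }\pi_2\}|$. Given a block length $b$ (intended so that $b\alpha_i$ and $b\beta_i$ are integers), a ranking $\pi$ is $(\bar{\alpha},\bar{\beta})$-block-$k$-fair if for every prefix $P$ of $\pi$ with $|P|\ge k$ and $|P|\equiv 0 \pmod b$, and every $i\in[g]$, $\alpha_i|P|\le|P\cap G_i|\le\beta_i|P|$. A closest such ranking to $\pi$ is one minimizing $\mathcal{K}(\pi,\cdot)$ over all block-$k$-fair rankings (assumed to exist; otherwise the algorithm may report none exists). *)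

(* Defs.v *)
From mathcomp Require Import all_boot all_order all_algebra all_fingroup.

Set Implicit Arguments.
Unset Strict Implicit.
Unset Printing Implicit Defensive.

Import Order.TTheory GRing.Theory Num.Theory.

(** * Rankings and block fairness *)

(** A ranking is a permutation [pi : 'S_d] sending a position to the candidate
    placed there; positions and candidates are numbered from 0. *)
Section Rankings.
Variable d : nat.
Implicit Types pi sigma : 'S_d.

Definition before pi (a c : 'I_d) : bool :=
  ((pi^-1)%g a < (pi^-1)%g c)%N.

Definition kendall_tau pi sigma : nat :=
  #|[set p : 'I_d * 'I_d | before pi p.1 p.2 && before sigma p.2 p.1]|.

Definition ranking_prefix pi (m : nat) : {set 'I_d} :=
  [set pi j | j : 'I_d & (j < m)%N].

Variables (g : nat) (G : 'I_g -> {set 'I_d}) (alpha beta : 'I_g -> rat).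

Definition block_fair (k b : nat) pi : Prop :=
  forall m : nat, (m <= d)%N ->
  let P := ranking_prefix pi m in
  (k <= #|P|)%N -> (b %| #|P|)%N ->
  forall i : 'I_g,
    (alpha i * #|P|%:R <= #|P :&: G i|%:R <= beta i * #|P|%:R)%R.

Definition closest_block_fair (k b : nat) pi sigma : Prop :=
  block_fair k b sigma /\
  forall tau, block_fair k b tau ->
    (kendall_tau pi sigma <= kendall_tau pi tau)%N.

End Rankings.

(** * A word RAM *)

(** Memory consists of arrays of words, [m a j] being the word at index [j] of
    array [a].  An array name occurring in a program is a fixed literal, while
    indices are computed; a scalar variable is cell 0 of an array.  Words have
    [w] bits: every computed value is reduced modulo [2 ^ w].  Programs cannot
    refer to [w]. *)
Definition memory := nat -> nat -> nat.

Definition upd (m : memory) (a j v : nat) : memory :=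
  fun a' j' => if (a' == a) && (j' == j) then v else m a' j'.

Inductive binop := OpAdd | OpSub | OpMul | OpDiv | OpLt | OpEq.

(** [OpSub] is truncated at 0, [OpDiv] is the quotient, with value 0 for a zero
    divisor; [OpLt] and [OpEq] return 0 or 1. *)
Definition binop_sem (o : binop) (x y : nat) : nat :=
  match o with
  | OpAdd => x + y
  | OpSub => x - y
  | OpMul => x * y
  | OpDiv => x %/ y
  | OpLt => x < y
  | OpEq => x == y
  end.

Inductive expr :=
  | Const of nat
  | Read of nat & expr
  | Bin of binop & expr & expr.

Fixpoint eval (w : nat) (m : memory) (e : expr) : nat :=
  match e with
  | Const n => n %% 2 ^ w
  | Read a i => m a (eval w m i)
  | Bin o e1 e2 => binop_sem o (eval w m e1) (eval w m e2) %% 2 ^ w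
  end.

(** Unit cost for each constant, memory access and arithmetic operation. *)
Fixpoint cost (e : expr) : nat :=
  match e with
  | Const _ => 1
  | Read _ i => (cost i).+1
  | Bin _ e1 e2 => (cost e1 + cost e2).+1
  end.

(** [Write a i e] stores the value of [e] at index [i] of array [a]; in tests
    every nonzero word counts as true. *)
Inductive cmd :=
  | Skip
  | Write of nat & expr & expr
  | Seq of cmd & cmd
  | If of expr & cmd & cmd
  | While of expr & cmd.

(** [exec w c m t m'] : with [w]-bit words, [c] started in memory [m] halts in
    memory [m'] after exactly [t] time units. *)
Inductive exec (w : nat) : cmd -> memory -> nat -> memory -> Prop :=
  | ExecSkip m :
      exec w Skip m 1 m
  | ExecWrite a i e m :
      exec w (Write a i e) m (cost i + cost e).+1
           (upd m a (eval w m i) (eval w m e))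
  | ExecSeq c1 c2 m1 m2 m3 t1 t2 :
      exec w c1 m1 t1 m2 -> exec w c2 m2 t2 m3 ->
      exec w (Seq c1 c2) m1 (t1 + t2) m3
  | ExecIfTrue e c1 c2 m m' t :
      eval w m e != 0 -> exec w c1 m t m' ->
      exec w (If e c1 c2) m (cost e + t).+1 m'
  | ExecIfFalse e c1 c2 m m' t :
      eval w m e = 0 -> exec w c2 m t m' ->
      exec w (If e c1 c2) m (cost e + t).+1 m'
  | ExecWhileTrue e c m1 m2 m3 t1 t2 :
      eval w m1 e != 0 -> exec w c m1 t1 m2 -> exec w (While e c) m2 t2 m3 ->
      exec w (While e c) m1 (cost e + t1 + t2).+1 m3
  | ExecWhileFalse e c m :
      eval w m e = 0 ->
      exec w (While e c) m (cost e).+1 m.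

(** * Input and output conventions *)

(** The arrays in [s] are loaded as arrays 0, 1, 2, ...; all other cells are
    initially 0. *)
Definition load (s : seq (seq nat)) : memory :=
  fun a j => nth 0 (nth [::] s a) j.

(** Array 2 gives, for each candidate [x], the index of the group containing
    [x].  A rational in [0, 1] is given by its numerator and denominator. *)
Definition encode (d g : nat) (pi : 'S_d) (G : 'I_g -> {set 'I_d})
    (alpha beta : 'I_g -> rat) (k b : nat) : seq (seq nat) :=
  [:: [:: d; g; k; b];
      [seq nat_of_ord (pi j) | j <- enum 'I_d];
      [seq find (fun i => x \in G i) (enum 'I_g) | x <- enum 'I_d];
      [seq absz (numq (alpha i)) | i <- enum 'I_g];
      [seq absz (denq (alpha i)) | i <- enum 'I_g];
      [seq absz (numq (beta i)) | i <- enum 'I_g];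
      [seq absz (denq (beta i)) | i <- enum 'I_g]].

Definition max_entry (s : seq (seq nat)) : nat := \max_(x <- flatten s) x.

(** Words of at least [c * log2 N] bits, where [N] exceeds every input number
    by 2 (so that [N] is at least 2). *)
Definition enough_bits (c w : nat) (s : seq (seq nat)) : Prop :=
  (max_entry s).+2 ^ c <= 2 ^ w.

(** The output is a status word, in cell 0 of array 7, and a ranking, in
    array 8. *)
Definition reports_none (m : memory) : Prop := m 7 0 = 0.

Definition outputs (d : nat) (m : memory) (sigma : 'S_d) : Prop :=
  m 7 0 = 1 /\ forall j : 'I_d, m 8 j = sigma j.

(* Main.v *)
Require Import Defs.
From mathcomp Require Import all_boot all_order all_algebra all_fingroup zify ring.

(** The ranking is built greedily: each position receives the first remaining
    candidate of [pi] whose choice neither exceeds the upper bound of its group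
    at the next prefix length [n] where fairness is required, nor leaves fewer
    free places before [n] than the lower bounds at [n] still demand.

    Exchanging two candidates that a ranking [tau] inverts with respect to [pi]
    strictly decreases the Kendall tau distance, so a closest fair [tau] admits
    no fair exchange of this kind.  Such a [tau] is the greedy ranking.  Indeed,
    let [x] be the greedy choice at position [t], placed by [tau] after the
    prefix of length [n], and let [M] be the last multiple of [b] up to the
    position of [x].  Since no exchange with [x] is fair, each group either
    meets its lower bound at [M], or is not used between [t] and [M], or has
    exhausted its upper bound at [n] by position [t].  The bounds being
    proportional to the prefix length, each group has at [M] at most [M / n]
    times the elements it has at [n], and some group has strictly fewer;
    summing over the groups gives [M < M].

    Hence the greedy procedure gets stuck only if no fair ranking exists. *)

Set Implicit Arguments.
Unset Strict Implicit.
Unset Printing Implicit Defensive.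

Import Order.TTheory GRing.Theory Num.Theory.

(** * Optimality of the greedy ranking *)

Definition pos d (s : 'S_d) (x : 'I_d) : nat := (s^-1)%g x.

Lemma pos_inj d (s : 'S_d) : injective (pos s).
Proof. by move=> x y /val_inj /perm_inj. Qed.

Lemma pos_perm d (s : 'S_d) (j : 'I_d) : pos s (s j) = j.
Proof. by rewrite /pos permK. Qed.

Lemma ltn_pos d (s : 'S_d) x : pos s x < d.
Proof. exact: ltn_ord. Qed.

Lemma pos_eqE d (s : 'S_d) t (ltd : t < d) x : (pos s x == t) = (x == s (Ordinal ltd)).
Proof.
apply/eqP/eqP=> [e|->]; last by rewrite pos_perm.
by apply: (@pos_inj d s); rewrite pos_perm e.
Qed.

Lemma pos_swap d (s : 'S_d) x y z :
  pos (s * tperm x y)%g z = pos s (tperm x y z).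
Proof. by rewrite /pos invMg tpermV permM. Qed.

(** Relabelling pairs by the transposition turns each new inversion into an old one that disappears.
    The pair [(x, y)] disappears as well and is never such an image, whence strictness. *)
Lemma kendall_tau_swap d (pi tau : 'S_d) x y :
  pos pi x < pos pi y -> pos tau y < pos tau x ->
  kendall_tau pi (tau * tperm x y)%g < kendall_tau pi tau.
Proof.
move=> rxy pyx; set tau' := (tau * _)%g; rewrite /kendall_tau.
set D' := [set p | _]; set D := [set p | _ && before tau _ _].
pose sw (q : 'I_d * 'I_d) := (tperm x y q.1, tperm x y q.2).
(* [phi] maps the inversions of [tau'] injectively to those of [tau], missing [(x, y)]. *)
pose phi q := if q \in D then q else sw q.
have swK : involutive sw by case=> a c; rewrite /sw /= !tpermK.
have inD q : q \in D = (pos pi q.1 < pos pi q.2) && (pos tau q.2 < pos tau q.1).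
  by rewrite inE.
have inD' q : q \in D' =
    (pos pi q.1 < pos pi q.2) && (pos tau (sw q).2 < pos tau (sw q).1).
  by rewrite inE -!pos_swap.
have key q : q \in D' -> q \notin D -> [&& sw q \in D, sw q \notin D' & sw q != (x, y)].
  case: q => a c; rewrite !inD !inD' swK /sw /= xpair_eqE.
  by case: tpermP => [->|->|/eqP na /eqP na']; case: tpermP => [->|->|/eqP nc /eqP nc'];
    rewrite ?eqxx ?(negbTE na) ?(negbTE nc) /=; lia.
have xyD : (x, y) \in D by rewrite inD /= rxy.
have xyD' : (x, y) \notin D' by rewrite inD' /= tpermL tpermR; lia.
rewrite (cardsD1 (x, y) D) xyD add1n ltnS.
rewrite -(card_in_imset (f := phi) (D := D')); last first.
  move=> q q' Dq Dq'; rewrite /phi; case: ifPn => qD; case: ifPn => qD' //.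
  - by move=> e; move: (key _ Dq' qD'); rewrite -e Dq /= andbF.
  - by move=> e; move: (key _ Dq qD); rewrite e Dq' /= andbF.
  - exact: (inv_inj swK).
apply/subset_leq_card/subsetP=> _ /imsetP[q Dq ->]; rewrite in_setD1.
rewrite /phi; case: ifPn => qD.
  by rewrite qD andbT; apply: contraNneq xyD' => <-.
by case/and3P: (key _ Dq qD) => -> _ ->.
Qed.

Lemma ltn_sum_ex (I : finType) (F F' : I -> nat) :
  \sum_i F i < \sum_i F' i -> exists i, F i < F' i.
Proof.
move=> lt; apply/existsP; apply: contraLR lt.
rewrite negb_exists => /forallP H; rewrite -leqNgt; apply: leq_sum => i _.
by rewrite leqNgt.
Qed.

Section Greedy.

Variables (d g : nat) (pi : 'S_d) (grp : 'I_d -> 'I_g) (k b : nat).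
Variables L U : 'I_g -> nat -> nat.
Implicit Types (tau : 'S_d) (x y z : 'I_d) (f : 'I_g) (m n t : nat).

(** * Group counts of prefixes *)

Definition cnt tau m f : nat := \sum_x ((pos tau x < m) && (grp x == f)).

Lemma cnt0 tau f : cnt tau 0 f = 0.
Proof. by rewrite /cnt big1. Qed.

Lemma cntS tau t (ltd : t < d) f :
  cnt tau t.+1 f = cnt tau t f + (grp (tau (Ordinal ltd)) == f).
Proof.
rewrite /cnt (bigD1 (tau (Ordinal ltd))) //= [in RHS](bigD1 (tau (Ordinal ltd))) //=.
rewrite pos_perm /= ltnSn ltnn /= add0n addnC; congr (_ + _).
apply: eq_bigr => x; rewrite -pos_eqE ltnS leq_eqVlt => /negbTE-> //.
Qed.

Lemma leq_cnt tau f m n : m <= n -> cnt tau m f <= cnt tau n f.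
Proof. by move=> mn; apply: leq_sum => x _; lia. Qed.

Lemma eq_cnt tau f m n : m <= n ->
  (forall z, grp z = f -> m <= pos tau z -> pos tau z < n -> False) ->
  cnt tau n f = cnt tau m f.
Proof.
move=> mn H; apply: eq_bigr => z _; case: eqP => [/H {}H|]; last by rewrite !andbF.
by rewrite !andbT; congr nat_of_bool; case: ltnP; case: ltnP => //; lia.
Qed.

Lemma sum_cnt tau m : m <= d -> \sum_f cnt tau m f = m.
Proof.
elim: m => [|m IH] md; first by rewrite big1 // => f _; rewrite cnt0.
under eq_bigr => f _ do rewrite (cntS tau md).
rewrite big_split /= IH 1?ltnW // -addn1; congr (_ + _).
by rewrite (bigD1 (grp (tau (Ordinal md)))) //= eqxx big1 // => f /negbTE; rewrite eq_sym => ->.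
Qed.

(** The swap trades [y] for [x] in exactly the prefixes that reach [y] but not [x]. Additions on
    both sides avoid truncated subtraction. *)
Lemma cnt_swap tau x y m f : pos tau y < pos tau x ->
  cnt (tau * tperm x y)%g m f + [&& pos tau y < m, m <= pos tau x & grp y == f]
  = cnt tau m f + [&& pos tau y < m, m <= pos tau x & grp x == f].
Proof.
move=> pyx; have nyx : y != x by apply: contraTneq pyx => ->; rewrite ltnn.
rewrite /cnt !(bigD1 (P := xpredT) x) //= !(bigD1 (P := fun i => i != x) y) //=.
rewrite !pos_swap tpermL tpermR.
rewrite (eq_bigr (fun z => nat_of_bool ((pos tau z < m) && (grp z == f)))).
  by case: (grp x == f); case: (grp y == f); lia.
by move=> z /andP[nx ny]; rewrite pos_swap tpermD // eq_sym.
Qed.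

(** * Fairness and eligibility *)

Definition boundary m := [&& k <= m, b %| m & m <= d].

Definition fair tau := forall m, boundary m ->
  forall f, L f m <= cnt tau m f <= U f m.

(* The least multiple of [b] that is greater than [t] and at least [k]. *)
Definition nxt t := ((t + (k - 1 - t)) %/ b).+1 * b.

Definition need tau t := \sum_f (L f (nxt t) - cnt tau t f).

(* [x] can be placed at position [t] after the first [t] entries of [tau]; the
   truncated differences in [need] drop by one if the group of [x] is below its
   lower bound and do not change otherwise. *)
Definition elig tau t x := (t <= pos tau x) &&
  ((d < nxt t) || ((cnt tau t (grp x) < U (grp x) (nxt t)) &&
     (need tau t + (L (grp x) (nxt t) <= cnt tau t (grp x)) <= nxt t - t))).

Definition first_elig tau t x :=
  elig tau t x /\ forall y, pos pi y < pos pi x -> ~~ elig tau t y.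

Lemma dvd_nxt t : b %| nxt t. Proof. exact: dvdn_mull. Qed.

Hypotheses (k_gt0 : 0 < k) (b_gt0 : 0 < b).
(** Proportionality to the prefix length, cross-multiplied to stay in [nat]. *)
Hypothesis L_linear : forall f m n, b %| m -> b %| n -> n * L f m = m * L f n.
Hypothesis U_linear : forall f m n, b %| m -> b %| n -> n * U f m = m * U f n.

Lemma nxt_bounds t : (t < nxt t) && (k <= nxt t).
Proof. by have := ltn_ceil (t + (k - 1 - t)) b_gt0; rewrite /nxt; lia. Qed.

Lemma nxt_min t m : t < m -> k <= m -> b %| m -> nxt t <= m.
Proof.
move=> tm km /dvdnP[q e]; rewrite /nxt e leq_mul2r; apply/orP; right.
by rewrite ltn_divLR // -e; have := k_gt0; lia.
Qed.

Lemma L_mono f m n : b %| m -> b %| n -> m <= n -> L f m <= L f n.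
Proof.
case: m => [|m] bm bn mn; last by have := L_linear f bm bn; nia.
(* For [m = 0], comparison with the positive length [b] forces [L f 0 = 0]. *)
have := L_linear f bm (dvdnn b); nia.
Qed.

Lemma U_mono f m n : b %| m -> b %| n -> m <= n -> U f m <= U f n.
Proof.
case: m => [|m] bm bn mn; last by have := U_linear f bm bn; nia.
have := U_linear f bm (dvdnn b); nia.
Qed.

(** * The exchange argument *)

Definition swap_optimal tau := fair tau /\
  forall x y, pos pi x < pos pi y -> pos tau y < pos tau x ->
  ~ fair (tau * tperm x y)%g.

(** Only boundaries between the two positions see the swap: there the group of [y] loses one element
    and that of [x] gains one. Slack in these two bounds would make the swap fair. *)
Lemma swap_blocked tau x y : swap_optimal tau ->
  pos pi x < pos pi y -> pos tau y < pos tau x ->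
  (forall m, boundary m -> pos tau y < m -> m <= pos tau x -> grp x <> grp y ->
     L (grp y) m < cnt tau m (grp y) /\ cnt tau m (grp x) < U (grp x) m) ->
  False.
Proof.
move=> [ft opt] rxy pyx H; apply: (opt _ _ rxy pyx) => m bm f.
have := cnt_swap m f pyx; have := ft m bm f.
have [pym|] := ltnP (pos tau y) m; last by rewrite /= !addn0 => _ ? ->.
have [mpx|] := leqP m (pos tau x); last by rewrite /= !addn0 => _ ? ->.
have {}H := H m bm pym mpx; rewrite /=.
have [e|/eqP ne] := eqVneq (grp x) (grp y); first by rewrite e => ? /addIn ->.
have {H} := H ne.
by case: eqP => [<-|_]; case: eqP => [<-|_]; lia.
Qed.

Lemma group_sorted tau x y : swap_optimal tau -> grp x = grp y ->
  pos pi x < pos pi y -> pos tau x < pos tau y.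
Proof.
move=> opt gxy rxy; case: ltngtP => // [pyx|/pos_inj e].
  by case: (swap_blocked opt rxy pyx).
by rewrite e ltnn in rxy.
Qed.

(** Between [t] and the next boundary a fair ranking places at least what each group still demands.
    If the group of the entry demands nothing more, the entry itself is one place beyond the
    demand. *)
Lemma elig_swap_optimal tau t (ltd : t < d) :
  fair tau -> elig tau t (tau (Ordinal ltd)).
Proof.
move=> ft; rewrite /elig pos_perm leqnn /=; case: ltnP => //= nd.
set v := tau _; have /andP[tn kn] := nxt_bounds t.
have bn : boundary (nxt t) by rewrite /boundary kn dvd_nxt.
have ltc : cnt tau t (grp v) < cnt tau (nxt t) (grp v).
  by apply: (leq_trans _ (leq_cnt _ _ tn)); rewrite (cntS _ ltd) eqxx addn1.
have := ft _ bn (grp v) => /andP[lv uv]; rewrite (leq_trans ltc uv) /=.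
have <- : \sum_f (cnt tau (nxt t) f - cnt tau t f) = nxt t - t.
  by rewrite sumnB ?sum_cnt // ?(ltnW ltd) // => f _; apply: leq_cnt; apply: ltnW.
rewrite /need (bigD1 (grp v)) //= [leqRHS](bigD1 (grp v)) //= addnAC.
apply: leq_add; first by lia.
by apply: leq_sum => f _; have := ft _ bn f; lia.
Qed.

Lemma swap_optimal_first tau t (ltd : t < d) :
  swap_optimal tau -> first_elig tau t (tau (Ordinal ltd)).
Proof.
move=> opt; have [ft _] := opt; split; first exact: elig_swap_optimal.
move=> x0 rx0; apply/negP => ex0; set v := tau _ in rx0.
have {x0 rx0 ex0} [x [rxv ex xmin]] : exists x, [/\ pos pi x < pos pi v, elig tau t x &
    forall y, pos pi y < pos pi x -> ~~ elig tau t y].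
  case: (arg_minnP (pos pi) ex0) => x ex xmin; exists x; split=> //.
    exact: leq_ltn_trans (xmin _ ex0) rx0.
  by move=> y; rewrite ltnNge; apply: contraNN; apply: xmin.
have pv : pos tau v = t by rewrite pos_perm.
case/andP: (ex) => tx; have {tx} tx : t < pos tau x.
  rewrite ltn_neqAle tx andbT -pv; apply/eqP => /pos_inj e.
  by rewrite e ltnn in rxv.
have bnd_n m : boundary m -> t < m -> nxt t <= m.
  by case/and3P => *; apply: nxt_min.
(* When [x] lies before [nxt t], no boundary separates it from [t], so the swap is fair. *)
have [xn _|nx] := ltnP (pos tau x) (nxt t).
  apply: (swap_blocked opt rxv); rewrite pv // => m bm tm mx.
  by have := bnd_n m bm tm; lia.
have nd : nxt t < d := leq_ltn_trans nx (ltn_pos _ _).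
rewrite ltnNge (ltnW nd) /= => /andP[cU].
have /andP[tn kn] := nxt_bounds t.
have bn : boundary (nxt t) by rewrite /boundary kn dvd_nxt ltnW.
(* From [t] up to [x] the group of [x] does not occur: a member that [pi] ranks earlier would be
   eligible too, against the choice of [x], and a later one follows [x] in [tau]. *)
have cx m : t <= m -> m <= pos tau x -> cnt tau m (grp x) = cnt tau t (grp x).
  move=> tm mx; apply: eq_cnt => // z gz tz zm.
  case: (ltngtP (pos pi z) (pos pi x)) => [/xmin|rxz|/pos_inj e].
  - by move: ex; rewrite /elig gz tz => /andP[_ ->].
  - by have := group_sorted opt (esym gz) rxz; lia.
  - by move: zm; rewrite e; lia.
have := cx _ (ltnW tn) nx; have := ft _ bn (grp x) => /andP[lx ux] ecx.
(* The group of [x] thus meets its lower bound already at [t], and eligibility of [x] leaves a place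
   to spare beyond [need]. *)
rewrite -ecx lx addn1 => lt_need.
pose M := (pos tau x) %/ b * b.
have Mx : M <= pos tau x by apply: leq_trunc_div.
have bM : b %| M by apply: dvdn_mull.
have nM : nxt t <= M.
  have [q e] := dvdnP (dvd_nxt t); rewrite /M e leq_mul2r; apply/orP; right.
  by rewrite leq_divRL // -e.
have bdM : boundary M by rewrite /boundary bM (leq_trans kn nM) (leq_trans Mx) // ltnW // ltn_pos.
have split_f f : [\/ cnt tau M f = L f M, cnt tau M f = cnt tau t f
    | cnt tau t f = U f (nxt t)].
  have [->|nL] := eqVneq (cnt tau M f) (L f M); first by constructor 1.
  have [|zP] := boolP [forall z, ~~ [&& grp z == f, t <= pos tau z & pos tau z < M]].
    move/forallP => H; constructor 2; apply: eq_cnt; first by lia.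
    by move=> z gz tz zM; have := H z; rewrite gz eqxx tz zM.
  have [z0 {}zP] : exists z, [&& grp z == f, t <= pos tau z & pos tau z < M].
    by move: zP; rewrite negb_forall => /existsP[z]; rewrite negbK; exists z.
  case: (@arg_maxnP _ z0 (fun z => [&& grp z == f, t <= pos tau z & pos tau z < M]) (pos tau) zP) => z /and3P[/eqP gz tz zM] zmax.
  have LM : L f M < cnt tau M f by have := ft _ bdM f; lia.
  (* Here [z] is the last member of group [f] before [M]. If [pi] prefers [x], swapping the two is
     fair: past [z] the group already has its count at [M], above [L f M], and the group of [x]
     keeps its slack below [U]. *)
  have [rxz|rzx] := ltnP (pos pi x) (pos pi z).
    case: (swap_blocked opt rxz (leq_trans zM Mx)) => m bm zm mx _.
    have mM : m <= M.
      case/and3P: bm => _ /dvdnP[q e] _; rewrite /M e leq_mul2r; apply/orP; right.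
      by rewrite leq_divRL // -e.
    have tm : t < m := leq_ltn_trans tz zm.
    have bm' : b %| m by case/and3P: bm.
    have nm := bnd_n m bm tm; rewrite gz (cx _ (ltnW tm) mx); split; last first.
      by rewrite -ecx in cU; apply: leq_trans (U_mono _ (dvd_nxt t) bm' nm); rewrite -ecx.
    apply: leq_ltn_trans (L_mono _ bm' bM mM) _; rewrite -(@eq_cnt tau f m M) //.
    move=> u gu mu uM; have := zmax u; rewrite gu eqxx uM (leq_trans (ltnW tm) mu) /=; lia.
  have {}rzx : pos pi z < pos pi x.
    rewrite ltn_neqAle rzx andbT; apply/eqP=> /pos_inj e.
    by move: zM; rewrite e; lia.
  (* Now [pi] ranks [z] before [x], so [z] is not eligible. By [lt_need] it passes the demand test,
     hence the upper bound is what fails. *)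
  constructor 3; have := xmin _ rzx; rewrite /elig gz tz /=.
  rewrite ltnNge (ltnW nd) /= negb_and.
  have := ft _ bn f; have := leq_cnt tau f (ltnW tn).
  by case: (L f _ <= cnt tau t f); lia.
(* As the places up to [nxt t] exceed [need], some group [a] receives one of them and ends above its
   lower bound. *)
have [a La ta] : exists2 a, L a (nxt t) < cnt tau (nxt t) a & cnt tau t a < cnt tau (nxt t) a.
  have /ltn_sum_ex[a lt_a] :
      \sum_f (L f (nxt t) - cnt tau t f) < \sum_f (cnt tau (nxt t) f - cnt tau t f).
    rewrite [ltnRHS]sumnB => [|f _]; last by apply: leq_cnt; apply: ltnW.
    by rewrite !sum_cnt ?(ltnW ltd) ?(ltnW nd) //; move: lt_need; rewrite /need; lia.
  by exists a; lia.
have : \sum_f nxt t * cnt tau M f < \sum_f M * cnt tau (nxt t) f.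
  (* The three cases use, in order, proportionality of [L], the inequality [nxt t <= M], and
     proportionality of [U]. *)
  have le_f f : nxt t * cnt tau M f <= M * cnt tau (nxt t) f.
    have := L_linear f (dvd_nxt t) bM; have := U_linear f (dvd_nxt t) bM.
    have := ft _ bdM f; have := ft _ bn f; have := leq_cnt tau f (ltnW tn).
    by have := leq_cnt tau f nM; case: (split_f f); nia.
  (* For [a] the first case is strict and the other two are contradictory. *)
  rewrite (bigD1 a) //= [ltnRHS](bigD1 a) //= -addSn leq_add ?leq_sum //.
  have := L_linear a (dvd_nxt t) bM; have := ft _ bn a.
  by have := leq_cnt tau a nM; case: (split_f a); nia.
by rewrite -!big_distrr /= !sum_cnt ?(ltnW nd) ?(leq_trans Mx) ?(ltnW (ltn_pos _ _)) // mulnC ltnn.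
Qed.

(** Counts grow only while below the upper bound at [nxt t], which is at most the one at [m]. For
    the lower bounds, consider the last position before a boundary: one place is left, so at most
    one unit of demand remains, and the entry meets it. *)
Lemma elig_fair tau :
  (forall t (ltd : t < d), elig tau t (tau (Ordinal ltd))) -> fair tau.
Proof.
move=> el m /and3P[km bm md] f; apply/andP; split; last first.
  suff H t : t <= m -> cnt tau t f <= U f m by apply: H.
  elim: t => [|t IH] tm; first by rewrite cnt0.
  have ltd := leq_trans tm md; rewrite (cntS _ ltd).
  have [e|] := eqVneq; last by rewrite addn0 IH // ltnW.
  have nm := nxt_min tm km bm.
  have := el _ ltd; rewrite /elig ltnNge (leq_trans nm md) /= e => /and3P[_ lt_c _].
  by rewrite addn1 (leq_trans lt_c) // U_mono // dvd_nxt.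
case: m => [|t] in km bm md *; first by have := k_gt0; lia.
have nm : nxt t = t.+1.
  by apply/eqP; rewrite eqn_leq nxt_min //=; have /andP[] := nxt_bounds t.
have := el _ md; rewrite /elig nm ltnNge md /= subSnn => /and3P[_ _].
rewrite (cntS _ md) /need nm (bigD1 (grp (tau (Ordinal md)))) //=.
have [<-|ne] := eqVneq; first by lia.
by rewrite (bigD1 f) //= 1?eq_sym //; lia.
Qed.

(** * Closest rankings and uniqueness of the greedy ranking *)

Definition fairb tau := [forall m : 'I_d.+1, boundary m ==>
  [forall f, L f m <= cnt tau m f <= U f m]].

Lemma fairP tau : reflect (fair tau) (fairb tau).
Proof.
apply: (iffP forallP) => [H m bm f | H m]; last first.
  by apply/implyP => bm; apply/forallP => f; apply: H.
have md : m < d.+1 by case/and3P: bm.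
by move: (H (Ordinal md)) => /implyP/(_ bm)/forallP.
Qed.

Definition closest tau := fair tau /\
  forall tau', fair tau' -> kendall_tau pi tau <= kendall_tau pi tau'.

Lemma ex_closest : (exists tau, fair tau) -> exists tau, closest tau.
Proof.
case=> tau0 /fairP f0; case: (arg_minnP (kendall_tau pi) f0) => tau /fairP ft H.
by exists tau; split=> // tau' /fairP; apply: H.
Qed.

Lemma closest_swap_optimal tau : closest tau -> swap_optimal tau.
Proof.
move=> [ft H]; split=> // x y rxy pyx /H.
by rewrite leqNgt kendall_tau_swap.
Qed.

Section Agree.
Variables (s s' : 'S_d) (t : nat).
Hypothesis agree : forall j : 'I_d, j < t -> s j = s' j.

Lemma agree_pos x : (pos s x < t) = (pos s' x < t).
Proof.
have pK (u : 'S_d) z : u (u^-1 z)%g = z by rewrite permKV.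
apply/idP/idP => lt.
  by move: (agree lt); rewrite pK => ->; rewrite pos_perm.
by move: (agree lt); rewrite pK => <-; rewrite pos_perm.
Qed.

Lemma agree_cnt f : cnt s t f = cnt s' t f.
Proof. by apply: eq_bigr => x _; rewrite agree_pos. Qed.

(** Eligibility depends only on the set of the first [t] entries, so any completion may represent a
    partial ranking. *)
Lemma agree_elig x : elig s t x = elig s' t x.
Proof.
rewrite /elig !(leqNgt t) agree_pos agree_cnt; congr (_ && (_ || (_ && (_ + _ <= _)))).
by apply: eq_bigr => f _; rewrite agree_cnt.
Qed.

Lemma agree_first x : first_elig s t x -> first_elig s' t x.
Proof. by case=> e H; split=> [|y /H]; rewrite -agree_elig. Qed.
End Agree.

Lemma first_elig_inj tau t x y : first_elig tau t x -> first_elig tau t y -> x = y.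
Proof.
move=> [ex Hx] [ey Hy]; apply: (@pos_inj d pi x y).
by case: (ltngtP (pos pi x) (pos pi y)) => // [/Hy|/Hx]; rewrite ?ex ?ey.
Qed.

Definition greedy tau t := forall j : 'I_d, j < t -> first_elig tau j (tau j).

Lemma greedy_agree s tau t : swap_optimal tau -> greedy s t ->
  forall j : 'I_d, j < t -> s j = tau j.
Proof.
move=> opt; elim: t => [|t IH] gs j //; rewrite ltnS leq_eqVlt => /orP[/eqP e|jt].
  have ag (i : 'I_d) : i < j -> s i = tau i.
    by rewrite e; apply: IH => i' lt; apply: gs; apply: ltnW.
  apply: (@first_elig_inj tau j); first by apply: (agree_first ag); apply: gs; rewrite e.
  by have := swap_optimal_first (ltn_ord j) opt; rewrite (_ : Ordinal _ = j) //; apply: val_inj.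
by apply: IH jt => i lt; apply: gs; apply: ltnW.
Qed.

(** A fair ranking would yield a closest one, which agrees with [s] before [t] and whose entry at
    [t] is eligible. *)
Lemma greedy_stuck s t : t < d -> greedy s t -> (forall x, ~~ elig s t x) ->
  ~ exists tau, fair tau.
Proof.
move=> ltd gs stuck /ex_closest[tau /closest_swap_optimal opt].
have := stuck (tau (Ordinal ltd)); rewrite (agree_elig (greedy_agree opt gs)).
by case: (swap_optimal_first ltd opt) => ->.
Qed.

(** Minimality comes from uniqueness: [s] is fair, so a closest ranking exists, and being
    swap-optimal it coincides with [s]. *)
Lemma greedy_closest s : greedy s d -> closest s.
Proof.
move=> gs; have fs : fair s.
  by apply: elig_fair => t ltd; case: (gs (Ordinal ltd) ltd).
have [tau ct] := ex_closest (ex_intro _ s fs).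
suff -> : s = tau by [].
by apply/permP => j; apply: (greedy_agree (closest_swap_optimal ct) gs).
Qed.

Lemma greedy_step s t x (ltd : t < d) : greedy s t -> first_elig s t x ->
  exists s', [/\ greedy s' t.+1, s' (Ordinal ltd) = x &
     forall j : 'I_d, j < t -> s j = s' j].
Proof.
move=> gs fx; pose o := Ordinal ltd.
(* This exchanges the entry at [t] with [x], which lies at [t] or later, so the earlier entries
   stay. *)
pose s' := (tperm o (s^-1 x) * s)%g.
have ag (j : 'I_d) : j < t -> s j = s' j.
  move=> jt; rewrite permM tpermD //; apply/eqP => e; move: jt; rewrite -e.
    by rewrite /= ltnn.
  by case: fx => /andP[tx _] _; rewrite ltnNge tx.
have s'o : s' o = x by rewrite permM tpermL permKV.
exists s'; split=> // j; rewrite ltnS leq_eqVlt => /orP[/eqP e|jt].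
  have -> : j = o by apply: val_inj.
  by rewrite s'o /=; apply: (agree_first ag).
rewrite -ag //; apply: (agree_first _ (gs _ jt)) => i ij.
by apply: ag; apply: ltn_trans ij jt.
Qed.

End Greedy.

(** * Total correctness with time bounds for the RAM *)

Lemma upd_ne m a j v a' j' : a' != a -> upd m a j v a' j' = m a' j'.
Proof. by rewrite /upd => /negbTE->. Qed.

Lemma upd_same m a j v j' : upd m a j v a j' = if j' == j then v else m a j'.
Proof. by rewrite /upd eqxx. Qed.

Lemma upd_eq m a j v : upd m a j v a j = v.
Proof. by rewrite upd_same eqxx. Qed.

(** Arithmetic without reduction modulo [2 ^ w]; it agrees with the machine under [fits]. *)
Fixpoint value (m : memory) (e : expr) : nat :=
  match e with
  | Const n => n
  | Read a i => m a (value m i)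
  | Bin o e1 e2 => binop_sem o (value m e1) (value m e2)
  end.

Fixpoint fits (w : nat) (m : memory) (e : expr) : Prop :=
  match e with
  | Const n => n < 2 ^ w
  | Read _ i => fits w m i
  | Bin o e1 e2 => [/\ fits w m e1, fits w m e2
                     & binop_sem o (value m e1) (value m e2) < 2 ^ w]
  end.

Lemma eval_value w m e : fits w m e -> eval w m e = value m e.
Proof.
elim: e => [n|a i IH|o e1 IH1 e2 IH2] /=; first exact: modn_small.
  by move/IH->.
by case=> /IH1-> /IH2-> /modn_small.
Qed.

Definition run w c m T (Q : memory -> Prop) : Prop :=
  exists t m', [/\ exec w c m t m', t <= T & Q m'].

Section Run.
Variable w : nat.
Implicit Types (c : cmd) (m : memory) (T : nat) (Q : memory -> Prop).

Lemma run_weaken c m T T' Q Q' : run w c m T Q -> T <= T' ->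
  (forall m', Q m' -> Q' m') -> run w c m T' Q'.
Proof.
by move=> [t [m' [ex tT /[swap] TT' /[swap] QQ' /QQ' ?]]]; exists t, m'; split=> //; apply: leq_trans TT'.
Qed.

Lemma run_le c m T T' Q : run w c m T Q -> T <= T' -> run w c m T' Q.
Proof. by move=> r le; apply: run_weaken r le _. Qed.

Lemma run_skip m Q : Q m -> run w Skip m 1 Q.
Proof. by move=> q; exists 1, m; split=> //; apply: ExecSkip. Qed.

Lemma run_write a i e m Q : fits w m i -> fits w m e ->
  Q (upd m a (value m i) (value m e)) ->
  run w (Write a i e) m (cost i + cost e).+1 Q.
Proof.
move=> fi fe q; exists (cost i + cost e).+1, (upd m a (value m i) (value m e)).
by split=> //; rewrite -!(@eval_value w) //; apply: ExecWrite.
Qed.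

Lemma run_seq c1 c2 m T1 T2 Q :
  run w c1 m T1 (fun m1 => run w c2 m1 T2 Q) -> run w (Seq c1 c2) m (T1 + T2) Q.
Proof.
move=> [t1 [m1 [ex1 le1 [t2 [m2 [ex2 le2 q]]]]]]; exists (t1 + t2), m2.
by split=> //; [apply: ExecSeq ex1 ex2 | apply: leq_add].
Qed.

Lemma run_if e c1 c2 m T1 T2 Q : fits w m e ->
  (value m e != 0 -> run w c1 m T1 Q) -> (value m e = 0 -> run w c2 m T2 Q) ->
  run w (If e c1 c2) m (cost e + (T1 + T2)).+1 Q.
Proof.
move=> fe; rewrite -(eval_value fe) => H1 H2.
have [e0|e0] := eqVneq (eval w m e) 0.
  have [t [m' [ex le q]]] := H2 e0; exists (cost e + t).+1, m'.
  by split=> //; [apply: ExecIfFalse | lia].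
have [t [m' [ex le q]]] := H1 e0; exists (cost e + t).+1, m'.
by split=> //; [apply: ExecIfTrue | lia].
Qed.

(** [Inv] is indexed by the number of completed iterations; the last summand of the bound pays for
    the failing test. *)
Lemma run_while e c m N T (Inv : nat -> memory -> Prop) Q :
  Inv 0 m ->
  (forall i m, i < N -> Inv i m -> fits w m e /\ value m e != 0) ->
  (forall i m, i < N -> Inv i m -> run w c m T (Inv i.+1)) ->
  (forall m, Inv N m -> [/\ fits w m e, value m e = 0 & Q m]) ->
  run w (While e c) m (N * (cost e + T).+1 + (cost e).+1) Q.
Proof.
move=> inv0 He Hc HQ.
suff H n i m' : i + n = N -> Inv i m' ->
    run w (While e c) m' (n * (cost e + T).+1 + (cost e).+1) Q by exact: (H N 0).
elim: n i m' => [|n IH] i m' iN inv.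
  rewrite addn0 in iN; rewrite iN in inv; have [fe e0 q] := HQ _ inv.
  exists (cost e).+1, m'; split=> //; apply: ExecWhileFalse.
  by rewrite (eval_value fe).
have ltN : i < N by lia.
have [fe e0] := He _ _ ltN inv; have [t [m1 [ex le inv1]]] := Hc _ _ ltN inv.
have [t2 [m2 [ex2 le2 q]]] := IH _ _ (etrans (addSnnS i n) iN) inv1.
exists (cost e + t + t2).+1, m2; split=> //; last by rewrite mulSn; lia.
by apply: ExecWhileTrue ex ex2; rewrite (eval_value fe).
Qed.
End Run.

(** * The greedy program *)

(* Arrays 0-8 hold the input and the output; the others are
   9: whether the candidate at each position of [pi] is already placed,
   10: number of placed candidates of each group, 11: number of placed candidates,
   12: next prefix length at which fairness is required,
   13: number of placements that the lower bounds there still demand,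
   14 and 15: loop counters, 16: position in [pi] of the next candidate. *)
Definition var a := Read a (Const 0).
Definition incr a := Write a (Const 0) (Bin OpAdd (var a) (Const 1)).
Definition dE := var 0.
Definition gE := Read 0 (Const 1).
Definition kE := Read 0 (Const 2).
Definition bE := Read 0 (Const 3).
Definition boundE num den f :=
  Bin OpDiv (Bin OpMul (Read num f) (var 12)) (Read den f).

Definition nxt_cmd := Write 12 (Const 0)
  (Bin OpMul (Bin OpAdd (Bin OpDiv
     (Bin OpAdd (var 11) (Bin OpSub (Bin OpSub kE (Const 1)) (var 11))) bE)
     (Const 1)) bE).

Definition need_body := Seq
  (Write 13 (Const 0)
     (Bin OpAdd (var 13) (Bin OpSub (boundE 3 4 (var 14)) (Read 10 (var 14)))))
  (incr 14).

Definition need_cmd :=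
  Seq (Write 13 (Const 0) (Const 0)) (Seq (Write 14 (Const 0) (Const 0))
  (While (Bin OpLt (var 14) gE) need_body)).

Definition candE := Read 2 (Read 1 (var 15)).

(** Products serve as conjunctions and sums as disjunctions; [<=] is tested as [<] against the
    successor. The comparison of cell 16 with [d] lets only the first hit count. *)
Definition eligE :=
  Bin OpMul (Bin OpMul (Bin OpEq (var 16) dE) (Bin OpEq (Read 9 (var 15)) (Const 0)))
  (Bin OpAdd (Bin OpLt dE (var 12))
    (Bin OpMul (Bin OpLt (Read 10 candE) (boundE 5 6 candE))
      (Bin OpLt
        (Bin OpAdd (var 13) (Bin OpLt (boundE 3 4 candE) (Bin OpAdd (Read 10 candE) (Const 1))))
        (Bin OpAdd (Bin OpSub (var 12) (var 11)) (Const 1))))).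

Definition scan_cmd :=
  Seq (Write 16 (Const 0) dE) (Seq (Write 15 (Const 0) (Const 0))
  (While (Bin OpLt (var 15) dE)
     (Seq (If eligE (Write 16 (Const 0) (var 15)) Skip) (incr 15)))).

Definition place_cmd :=
  Seq (Write 8 (var 11) (Read 1 (var 16))) (Seq (Write 9 (var 16) (Const 1))
  (Write 10 (Read 2 (Read 1 (var 16)))
     (Bin OpAdd (Read 10 (Read 2 (Read 1 (var 16)))) (Const 1)))).

Definition step_cmd :=
  Seq nxt_cmd (Seq need_cmd (Seq scan_cmd
  (If (Bin OpLt (var 16) dE) place_cmd (Write 7 (Const 0) (Const 0))))).

(** After a failure the remaining iterations only advance the counter, so there are always [d] of
    them. *)
Definition fair_ranking_cmd :=
  Seq (Write 7 (Const 0) (Const 1))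
  (While (Bin OpLt (var 11) dE) (Seq (If (var 7) step_cmd Skip) (incr 11))).

(** * Correctness and running time of the program *)

Section Program.

Variables (d g : nat) (pi : 'S_d) (grp : 'I_d -> 'I_g) (k b w : nat).
Variables an ad bn bd : 'I_g -> nat.
Let L f m := an f * m %/ ad f.
Let U f m := bn f * m %/ bd f.
Hypotheses (d_gt0 : 0 < d) (k_gt0 : 0 < k) (le_kd : k <= d) (b_gt0 : 0 < b).
Hypothesis L_linear : forall f m n, b %| m -> b %| n -> n * L f m = m * L f n.
Hypothesis U_linear : forall f m n, b %| m -> b %| n -> n * U f m = m * U f n.

Variable N : nat.
Hypotheses (N_gt2 : 2 < N) (ltdN : d < N) (ltgN : g < N) (ltbN : b < N).
Hypotheses (ltanN : forall f, an f < N) (ltbnN : forall f, bn f < N).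
Hypothesis N_fits : N ^ 6 <= 2 ^ w.
Implicit Types (m : memory) (s : 'S_d) (t : nat).

Record inputs m : Prop := Inputs {
  in_d : m 0 0 = d; in_g : m 0 1 = g; in_k : m 0 2 = k; in_b : m 0 3 = b;
  in_pi : forall j : 'I_d, m 1 j = pi j;
  in_grp : forall x : 'I_d, m 2 x = grp x;
  in_an : forall f : 'I_g, m 3 f = an f; in_ad : forall f : 'I_g, m 4 f = ad f;
  in_bn : forall f : 'I_g, m 5 f = bn f; in_bd : forall f : 'I_g, m 6 f = bd f }.

Lemma inputs_upd m a j v : 6 < a -> inputs m -> inputs (upd m a j v).
Proof.
by move=> a6 [*]; split=> *; rewrite upd_ne //; apply: contraTneq a6 => <-.
Qed.

(* The partial output is represented as the first [t] entries of a full
   permutation [s], whose other entries are irrelevant. *)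
Record state s t m : Prop := State {
  st_inputs :> inputs m;
  st_t : m 11 0 = t;
  st_status : m 7 0 = 1;
  st_out : forall j : 'I_d, j < t -> m 8 j = s j;
  st_used : forall j : 'I_d, m 9 j = (pos s (pi j) < t);
  st_cnt : forall f : 'I_g, m 10 f = cnt grp s t f }.

Lemma state_upd s t m a j v : 11 < a -> state s t m -> state s t (upd m a j v).
Proof.
move=> a11 [*]; split; first by apply: inputs_upd => //; lia.
all: by move=> *; rewrite upd_ne; auto; apply: contraTneq a11 => <-.
Qed.

Let n t := nxt k b t.

(** The largest intermediate values are sums over fewer than [N] groups of bounds of order [N ^ 2].
    As [N >= 3], the sixth power leaves a factor 27 above [N ^ 3]. *)
Lemma fits_chain : [/\ 3 * N <= N ^ 2, 3 * N ^ 2 <= N ^ 3 & 27 * N ^ 3 <= 2 ^ w].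
Proof.
split; [by rewrite leq_mul2r N_gt2 orbT | by rewrite (expnS N 2) leq_mul2r N_gt2 orbT |].
apply: leq_trans N_fits; rewrite (expnD N 3 3) leq_mul2r (_ : 27 = 3 ^ 3) // leq_exp2r //.
by rewrite N_gt2 orbT.
Qed.

Lemma nxt_le t : t < d -> n t <= 2 * N.
Proof.
by move=> td; have := leq_trunc_div (t + (k - 1 - t)) b; rewrite /n /nxt mulSn; lia.
Qed.

Lemma bound_le (c : 'I_g -> nat) f t : t < d -> (forall f, c f < N) ->
  c f * n t <= 2 * N ^ 2.
Proof. by move=> /nxt_le le H; rewrite [2 * _]mulnCA leq_mul // ltnW. Qed.

Definition part_need s t i := \sum_(f < g | f < i) (L f (n t) - cnt grp s t f).

Lemma part_needS s t i (ltg : i < g) :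
  part_need s t i.+1 = part_need s t i + (L (Ordinal ltg) (n t) - cnt grp s t (Ordinal ltg)).
Proof.
rewrite /part_need (bigD1 (Ordinal ltg)) //= addnC; congr (_ + _).
apply: eq_bigl => f; rewrite -val_eqE /=; lia.
Qed.

Lemma part_need_le s t i : t < d -> i <= g -> part_need s t i <= 2 * N ^ 3.
Proof.
move=> td ig; apply: leq_trans (_ : g * (2 * N ^ 2) <= _); last first.
  by rewrite expnS mulnCA leq_mul2l leq_mul2r (ltnW ltgN) !orbT.
have -> : g * (2 * N ^ 2) = \sum_(f < g) 2 * N ^ 2 by rewrite sum_nat_const card_ord.
rewrite /part_need big_mkcond /=; apply: leq_sum => f _.
case: ifP => // _; apply: leq_trans (leq_subr _ _) _.
exact: leq_trans (leq_div _ _) (bound_le _ td ltanN).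
Qed.

Lemma need_partE s t : need grp k b L s t = part_need s t g.
Proof. by apply: eq_bigl => f; rewrite ltn_ord. Qed.

Lemma run_nxt s t m : t < d -> state s t m ->
  run w nxt_cmd m 20 (fun m' => state s t m' /\ m' 12 0 = n t).
Proof.
move=> td st; have [N2 N3 Nw] := fits_chain; have := nxt_le td => le_n.
have le_div := leq_div (t + (k - 1 - t)) b.
eapply run_le; first apply: run_write.
- by rewrite /=; lia.
- rewrite /= (in_k st) (in_b st) (st_t st) addn1 -/(nxt k b t) -/(n t).
  by repeat split=> //; lia.
- rewrite /= (in_k st) (in_b st) (st_t st) addn1 -/(nxt k b t).
  exact: (conj (state_upd _ _ _ st) (upd_eq _ _ _ _)).
- by [].
Qed.

Lemma run_need s t m : t < d -> state s t m -> m 12 0 = n t ->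
  run w need_cmd m (g * 40 + 20)
    (fun m' => [/\ state s t m', m' 12 0 = n t & m' 13 0 = need grp k b L s t]).
Proof.
move=> td st m12; have [N2 N3 Nw] := fits_chain; have le_n := nxt_le td.
pose Inv i m' := [/\ state s t m', m' 12 0 = n t, m' 14 0 = i & m' 13 0 = part_need s t i].
eapply run_le.
  apply: run_seq; apply: run_write => /=; [lia|lia|].
  apply: run_seq; apply: run_write => /=; [lia|lia|].
  apply: (run_while (N := g) (Inv := Inv)).
  - split; [by do 2![apply: state_upd => //] | by rewrite !upd_ne | by rewrite upd_eq |].
    by rewrite upd_ne // upd_eq /part_need big1.
  - move=> i m' ig [st' m12' m14 m13]; rewrite /= m14 (in_g st') ig; repeat split; lia.
  - move=> i m' ig [st' m12' m14 m13].
    pose f := Ordinal ig.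
    have := bound_le f td ltanN; have := part_need_le s td (ltnW ig).
    have := part_need_le s td ig; rewrite (part_needS _ _ ig) -/f => le1 le2 le3.
    have le4 := leq_div (an f * n t) (ad f).
    apply: run_seq; apply: run_write => /=; first lia.
      rewrite m14 m12' m13 (in_an st' f) (in_ad st' f) (st_cnt st' f).
      by repeat split; rewrite /L /n in le1 le2 le3 le4 *; lia.
    apply: run_write => /=; first lia.
      by rewrite upd_ne // m14; repeat split; lia.
    split; first by do 2![apply: state_upd => //].
    - by rewrite !upd_ne.
    - by rewrite upd_eq upd_ne // m14 addn1.
    - rewrite upd_ne // upd_eq (part_needS _ _ ig) m14 m13 m12' -/f.
      by rewrite (in_an st' f) (in_ad st' f) (st_cnt st' f).
  - move=> m' [st' m12' m14 m13]; rewrite /= m14 (in_g st') ltnn.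
    by repeat split=> //; [lia..|rewrite need_partE].
by rewrite /=; nia.
Qed.

Notation elig := (elig grp k b L U).
Notation first_elig := (first_elig pi grp k b L U).
Notation need := (need grp k b L).
Notation greedy := (greedy pi grp k b L U).
Notation fair := (fair grp k b L U).

Lemma eligE_spec s t m (j : 'I_d) p : t < d -> state s t m ->
  m 12 0 = n t -> m 13 0 = need s t -> m 15 0 = j -> m 16 0 = p ->
  fits w m eligE /\ (value m eligE != 0) = (p == d) && elig s t (pi j).
Proof.
move=> td st m12 m13 m15 m16; have [N2 N3 Nw] := fits_chain; have le_n := nxt_le td.
pose x := pi j; pose f := grp x.
have := bound_le f td ltanN; have := bound_le f td ltbnN.
have le1 := leq_div (an f * n t) (ad f); have le2 := leq_div (bn f * n t) (bd f).
have le3 := part_need_le s td (leqnn g); rewrite -need_partE in le3 => le4 le5.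
have le6 : cnt grp s t f <= d.
  rewrite -{2}(sum_cnt grp s (leqnn d)) (bigD1 f) //=.
  by apply: leq_trans (leq_addr _ _); apply: leq_cnt; apply: ltnW.
rewrite /= m15 m16 m12 m13 (st_t st) (in_d st) (st_used st) (in_pi st) -/x (in_grp st) -/f.
rewrite (in_an st) (in_ad st) (in_bn st) (in_bd st) (st_cnt st) !addn1; split.
  have w8 : 8 < 2 ^ w by clear -N2 N3 Nw N_gt2; lia.
  have fits1 (c : bool) : c < 2 ^ w by case: c; lia.
  have fits2 (c c' : bool) : c + c' < 2 ^ w by case: c; case: c'; lia.
  have fits3 (c c' c'' : bool) : c * (c' + c'') < 2 ^ w by case: c; case: c'; case: c''; lia.
  rewrite !mulnb; repeat split; first [exact: fits1 | exact: fits2 | exact: fits3 | lia].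
rewrite /elig -/x -/f -/(L f (n t)) -/(U f (n t)) !ltnS (leqNgt t) -/(n t).
by case: (p == d); case: (_ < t); case: (d < _); case: (cnt _ _ _ _ < _); case: (_ <= n t - t).
Qed.

Lemma run_scan s t m : t < d -> state s t m -> m 12 0 = n t -> m 13 0 = need s t ->
  run w scan_cmd m (d * 100 + 20)
    (fun m' => state s t m' /\ ((m' 16 0 = d /\ forall x, ~~ elig s t x) \/
                 exists q : 'I_d, m' 16 0 = q /\ first_elig s t (pi q))).
Proof.
move=> td st m12 m13; have [N2 N3 Nw] := fits_chain.
(* The value [d] in cell 16 is the sentinel for no hit so far. *)
pose Inv i m' := [/\ state s t m', m' 12 0 = n t, m' 13 0 = need s t, m' 15 0 = i &
  (m' 16 0 = d /\ forall j : 'I_d, j < i -> ~~ elig s t (pi j)) \/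
  exists q : 'I_d, m' 16 0 = q /\ first_elig s t (pi q)].
eapply run_le.
  apply: run_seq; apply: run_write => /=; [lia|lia|].
  apply: run_seq; apply: run_write => /=; [lia|lia|].
  apply: (run_while (N := d) (Inv := Inv)).
  - split; [by do 2![apply: state_upd => //] | by rewrite !upd_ne | by rewrite !upd_ne
           | by rewrite upd_eq |].
    by left; rewrite upd_ne // upd_eq (in_d st).
  - move=> i m' id [st' m12' m13' m15 _]; rewrite /= m15 (in_d st') id; repeat split; lia.
  - move=> i m' id [st' m12' m13' m15 m16]; pose j := Ordinal id.
    have [fe ve] := @eligE_spec s t m' j _ td st' m12' m13' m15 erefl.
    apply: run_seq; apply: run_if; first exact: fe.
      rewrite ve => /andP[/eqP p_d el].
      apply: run_write => /=; [lia|lia|]; apply: run_write => /=; first lia.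
        by rewrite upd_ne // m15; repeat split; lia.
      split; [by do 2![apply: state_upd => //] | by rewrite !upd_ne | by rewrite !upd_ne
             | by rewrite upd_eq upd_ne // m15 addn1 |].
      right; exists j; rewrite upd_ne // upd_eq m15; split=> //; split=> // y.
      rewrite pos_perm => lt_y; case: m16 => [[_ H]|[q [q_d _]]]; last first.
        by move: (ltn_ord q); rewrite -q_d p_d ltnn.
      by have := H _ lt_y; rewrite permKV.
    move/eqP/negPn; rewrite ve => nel; apply: run_skip; apply: run_write => /=; first lia.
      by rewrite m15; repeat split; lia.
    split; [by apply: state_upd | by rewrite !upd_ne | by rewrite !upd_ne
           | by rewrite upd_eq m15 addn1 |].
    rewrite upd_ne //; case: m16 => [[p_d H]|]; last by right.
    left; split=> // j'; rewrite ltnS leq_eqVlt => /orP[/eqP e|/H //].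
    by move: nel; rewrite p_d eqxx /= (_ : j = j') //; apply: val_inj.
  - move=> m' [st' m12' m13' m15 m16]; rewrite /= m15 (in_d st') ltnn.
    repeat split=> //; try lia; case: m16 => [[p_d H]|]; last by right.
    by left; split=> // x; rewrite -(permKV pi x); apply: H.
by rewrite /=; nia.
Qed.

(** The arrays already describe [t.+1] placements while cell 11 still holds [t]; the main loop
    increments it afterwards, hence the [upd] in the postcondition. *)
Lemma run_place s t m (q : 'I_d) (td : t < d) : state s t m -> greedy s t ->
  m 16 0 = q -> first_elig s t (pi q) ->
  run w place_cmd m 40 (fun m' => [/\ inputs m', m' 11 0 = t &
    exists s', greedy s' t.+1 /\ state s' t.+1 (upd m' 11 0 t.+1)]).
Proof.
move=> st gs m16 fq; have [N2 N3 Nw] := fits_chain.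
have [s' [gs' s't ag]] := greedy_step td gs fq; pose f := grp (pi q).
have lec : cnt grp s t f <= d.
  rewrite -{2}(sum_cnt grp s (leqnn d)) (bigD1 f) //=.
  by apply: leq_trans (leq_addr _ _); apply: leq_cnt; apply: ltnW.
have pq : pos s' (pi q) = t by rewrite -s't pos_perm.
eapply run_le.
  apply: run_seq; apply: run_write => /=; [by lia|by lia|].
  rewrite m16 (in_pi st) (st_t st).
  apply: run_seq; apply: run_write => /=; [by lia|by lia|].
  rewrite upd_ne // m16.
  apply: run_write => /=.
  - by lia.
  - by rewrite !upd_ne // m16 (in_pi st) (in_grp st) (st_cnt st) -/f; repeat split; lia.
  rewrite !upd_ne // m16 (in_pi st) (in_grp st).
  split; [by do 3![apply: inputs_upd => //]; apply: st_inputs st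
         | exact: st_t st |].
  exists s'; split=> //; split.
  - by do 4![apply: inputs_upd => //]; apply: st_inputs st.
  - by rewrite upd_eq.
  - by rewrite !upd_ne // (st_status st).
  - move=> j; do 3![rewrite upd_ne //]; rewrite upd_same ltnS leq_eqVlt.
    case: eqP => [e _ | _ /= jt]; last by rewrite (st_out st) // ag.
    by rewrite -s't; congr (nat_of_ord (s' _)); apply: val_inj.
  - move=> j; rewrite upd_ne // upd_ne // upd_same upd_ne // ltnS leq_eqVlt.
    case: eqP => [/val_inj->|ne]; first by rewrite pq eqxx.
    have -> : (pos s' (pi j) == t) = false.
      by apply/eqP; rewrite -pq => /pos_inj/perm_inj e; case: ne; rewrite e.
    by rewrite (st_used st) (agree_pos ag).
  - move=> f'; rewrite upd_ne // upd_same !upd_ne // (cntS _ _ td) s't -(agree_cnt _ ag).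
    rewrite !(st_cnt st) val_eqE (eq_sym (grp _)); case: eqP => [->|_] //.
    by rewrite addn0.
by [].
Qed.

Lemma run_step s t m (td : t < d) : state s t m -> greedy s t ->
  run w step_cmd m (g * 40 + d * 100 + 200) (fun m' => [/\ inputs m', m' 11 0 = t &
    (exists s', greedy s' t.+1 /\ state s' t.+1 (upd m' 11 0 t.+1)) \/
    (m' 7 0 = 0 /\ ~ exists tau, fair tau)]).
Proof.
move=> st gs; have [N2 N3 Nw] := fits_chain; eapply run_le.
  apply: run_seq; apply: (run_weaken (run_nxt td st) (leqnn _)) => m1 [st1 m12].
  apply: run_seq; apply: (run_weaken (run_need td st1 m12) (leqnn _)) => m2 [st2 m12' m13].
  apply: run_seq; apply: (run_weaken (run_scan td st2 m12' m13) (leqnn _)) => m3 [st3 m16].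
  apply: run_if => /=.
  - by rewrite (in_d st3); repeat split; try lia; case: (_ < d); lia.
  - rewrite (in_d st3); case: m16 => [[-> _]|[q [mq fq]] _]; first by rewrite ltnn.
    by apply: (run_weaken (run_place td st3 gs mq fq) (leqnn _)) => m' [? ? ?]; split=> //; left.
  - rewrite (in_d st3); case: m16 => [[_ stuck] _|[q [-> _]]]; last by rewrite ltn_ord.
    apply: run_write => /=; [lia|lia|]; split.
    + by apply: inputs_upd => //; apply: st_inputs st3.
    + by rewrite upd_ne // (st_t st3).
    + by right; rewrite upd_eq; split=> //; apply: (greedy_stuck k_gt0 b_gt0 L_linear U_linear td gs stuck).
by rewrite /=; nia.
Qed.

(** Each of the [d] iterations costs a constant times [g + d + 1], and [g <= d] makes the total
    quadratic. *)
Lemma run_fair_ranking m : g <= d -> inputs m -> (forall a j, 6 < a -> m a j = 0) ->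
  run w fair_ranking_cmd m (1000 * d ^ 2) (fun m' =>
    (exists s, [/\ closest pi grp k b L U s, m' 7 0 = 1 & forall j : 'I_d, m' 8 j = s j]) \/
    (m' 7 0 = 0 /\ ~ exists tau, fair tau)).
Proof.
move=> gd inp m0; have [N2 N3 Nw] := fits_chain.
pose Inv t m' := [/\ inputs m', m' 11 0 = t &
  (exists s, greedy s t /\ state s t m') \/ (m' 7 0 = 0 /\ ~ exists tau, fair tau)].
eapply run_le.
  apply: run_seq; apply: run_write => /=; [lia|lia|].
  apply: (run_while (N := d) (Inv := Inv)).
  - split; [by apply: inputs_upd | by rewrite upd_ne // m0 |].
    (* Any permutation represents the empty partial ranking; [pi] is at hand. *)
    left; exists pi; split=> //; split=> // *; rewrite ?upd_eq ?upd_ne ?m0 ?cnt0 //.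
    by apply: inputs_upd.
  - by move=> i m' id [inp' mt _]; rewrite /= mt (in_d inp') id; repeat split; lia.
  - move=> t m' td [inp' mt ms]; apply: run_seq; apply: run_if => /=.
    + lia.
    + case: ms => [[s [gs st]] _|[-> //]].
      apply: (run_weaken (run_step td st gs) (leqnn _)) => m1 [inp1 mt1 ms].
      apply: run_write => /=; [lia|rewrite mt1; repeat split; lia|].
      rewrite mt1 addn1; split; [by apply: inputs_upd | by rewrite upd_eq |].
      by case: ms => [|[? ?]]; [left | right; rewrite upd_ne].
    + move=> m70; apply: run_skip; apply: run_write => /=; [lia|rewrite mt; repeat split; lia|].
      rewrite mt addn1; split; [by apply: inputs_upd | by rewrite upd_eq |].
      case: ms => [[s [_ st]]|[? ?]]; last by right; rewrite upd_ne.
      by move: m70; rewrite (st_status st).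
  - move=> m' [inp' mt ms]; rewrite /= mt (in_d inp') ltnn; repeat split=> //; try lia.
    case: ms => [[s [gs st]]|]; last by right.
    left; exists s; split; [exact: (greedy_closest k_gt0 b_gt0 L_linear U_linear gs) | exact: st_status st |].
    by move=> j; apply: (st_out st).
by rewrite /=; nia.
Qed.

End Program.

(** * Exactness of the rational bounds and of the input encoding *)

(** Integrality of [b * q] makes [q * m] an integer at multiples of [b], so the division is exact.
    This yields the proportionality needed by the exchange argument. *)
Lemma mulq_divn (q : rat) (b m : nat) : (0 <= q)%R -> (b%:R * q)%R \is a Num.int ->
  b %| m -> (((`|numq q| * m) %/ `|denq q|)%N%:R = q * m%:R :> rat)%R.
Proof.
move=> q0 /intrP[z ez] /dvdnP[h ->]; set D := `|denq q|%N.
have D0 : 0 < D by rewrite absz_gt0 denq_neq0.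
have qE : (q * D%:R = `|numq q|%N%:R)%R.
  rewrite /D !natr_absz !ger0_norm ?numq_ge0 ?denq_ge0 //.
  by rewrite -{1}(divq_num_den q) divfK // intr_eq0 denq_neq0.
have : (0 <= z)%R by rewrite -(ler_int rat) -ez mulr_ge0.
case: z ez => // z ez _.
suff -> : `|numq q|%N * (h * b) = z * h * D.
  by rewrite mulnK // natrM -[z%:R%R]ez natrM; ring.
apply/eqP; rewrite -(eqr_nat rat) !natrM -qE -[z%:R%R]ez; apply/eqP; ring.
Qed.

Lemma card_prefixI d g (grp : 'I_d -> 'I_g) (G : 'I_g -> {set 'I_d})
    (tau : 'S_d) m i : (forall x i, (x \in G i) = (grp x == i)) ->
  #|ranking_prefix tau m :&: G i| = cnt grp tau m i.
Proof.
move=> HG; rewrite -sum1_card big_mkcond /=; apply: eq_bigr => x _.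
rewrite inE HG (_ : (x \in ranking_prefix tau m) = (pos tau x < m)); first by case: (_ && _).
apply/imsetP/idP => [[j jm ->]|xm]; first by rewrite pos_perm; move: jm; rewrite inE.
by exists (tau^-1 x)%g; rewrite ?inE ?permKV.
Qed.

Lemma card_prefix d (tau : 'S_d) m : m <= d -> #|ranking_prefix tau m| = m.
Proof.
move=> md; rewrite card_imset; last exact: perm_inj.
have wi : injective (widen_ord md) by move=> i j /(congr1 val) /= /val_inj.
rewrite -[RHS]card_ord -[RHS](card_imset _ wi).
apply: eq_card => j; apply/idP/imsetP => [|[i _ ->]]; rewrite inE //= => jm.
by exists (Ordinal jm) => //; apply: val_inj.
Qed.

Section Glue.
Variables (d g : nat) (pi : 'S_d) (G : 'I_g -> {set 'I_d}) (alpha beta : 'I_g -> rat).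
Variables (k b : nat) (grp : 'I_d -> 'I_g).
Hypothesis grpE : forall x i, (x \in G i) = (grp x == i).
Hypotheses (alpha_ge0 : forall i, (0 <= alpha i)%R) (beta_ge0 : forall i, (0 <= beta i)%R).
Hypothesis alpha_int : forall i, (b%:R * alpha i)%R \is a Num.int.
Hypothesis beta_int : forall i, (b%:R * beta i)%R \is a Num.int.

Definition threshold (c : 'I_g -> rat) i m := `|numq (c i)|%N * m %/ `|denq (c i)|%N.

Lemma threshold_linear (c : 'I_g -> rat) i m n : (0 <= c i)%R ->
  (b%:R * c i)%R \is a Num.int -> b %| m -> b %| n ->
  n * threshold c i m = m * threshold c i n.
Proof.
move=> c0 ci bm bn; apply/eqP; rewrite -(eqr_nat rat) !natrM.
by rewrite !(mulq_divn c0 ci) //; apply/eqP; ring.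
Qed.

Lemma block_fairE tau : block_fair G alpha beta k b tau <->
  fair grp k b (threshold alpha) (threshold beta) tau.
Proof.
split=> [H m /and3P[km bm md] f | H m md P kP bP i].
  have := H m md; rewrite /= card_prefix // => /(_ km bm f).
  rewrite (card_prefixI _ _ _ grpE) -(mulq_divn (alpha_ge0 f) (alpha_int f) bm).
  by rewrite -(mulq_divn (beta_ge0 f) (beta_int f) bm) !ler_nat.
rewrite /P (card_prefixI _ _ _ grpE) card_prefix //.
move: kP bP; rewrite /P card_prefix // => km bm.
rewrite -(mulq_divn (alpha_ge0 i) (alpha_int i) bm) -(mulq_divn (beta_ge0 i) (beta_int i) bm).
by rewrite !ler_nat; apply: H; rewrite /boundary km bm.
Qed.

Lemma nth_enum_map n (F : 'I_n -> nat) (j : 'I_n) : nth 0 [seq F i | i <- enum 'I_n] j = F j.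
Proof. by rewrite (nth_map j) ?size_enum_ord // nth_ord_enum. Qed.

Lemma find_grp x : find (fun i => x \in G i) (enum 'I_g) = grp x.
Proof.
rewrite (eq_find (a2 := pred1 (grp x))); last by move=> i; rewrite grpE eq_sym.
by rewrite -[find _ _]/(index _ _) index_enum_ord.
Qed.

Lemma inputs_load : inputs pi grp k b
  (fun i => `|numq (alpha i)|%N) (fun i => `|denq (alpha i)|%N)
  (fun i => `|numq (beta i)|%N) (fun i => `|denq (beta i)|%N)
  (load (encode pi G alpha beta k b)).
Proof.
split=> // j; rewrite /load /=; try exact: nth_enum_map.
by rewrite nth_enum_map find_grp.
Qed.

End Glue.

Lemma leq_max_entry (s : seq (seq nat)) r x : r \in s -> x \in r -> x <= max_entry s.
Proof.
by move=> rs xr; apply: leq_bigmax_seq => //; apply/flattenP; exists r.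
Qed.

(** The partition separates distinct sets only; injectivity of [G] makes distinct indices name
    disjoint groups. *)
Lemma group_of d g (G : 'I_g -> {set 'I_d}) : injective G ->
  partition [set G i | i : 'I_g] [set: 'I_d] ->
  exists grp : 'I_d -> 'I_g, forall x i, (x \in G i) = (grp x == i).
Proof.
move=> injG /and3P[/eqP cov /trivIsetP triv _].
have cover_ex x : exists i, x \in G i.
  have : x \in cover [set G i | i : 'I_g] by rewrite cov.
  by case/bigcupP => _ /imsetP[i _ ->]; exists i.
have [grp grpP] := fin_all_exists cover_ex; exists grp => x i.
apply/idP/eqP => [xi|<- //]; apply: injG; apply/eqP; apply: contraTT (grpP x) => ne.
have inG j : G j \in [set G i | i : 'I_g] by apply: imset_f.
have := triv _ _ (inG _) (inG i) ne.
by rewrite disjoint_sym => /disjointFr/(_ xi) ->.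
Qed.

(** Blocks of a partition are nonempty, and choosing a representative of each group is injective. *)
Lemma leq_groups d g (G : 'I_g -> {set 'I_d}) (grp : 'I_d -> 'I_g) :
  partition [set G i | i : 'I_g] [set: 'I_d] ->
  (forall x i, (x \in G i) = (grp x == i)) -> g <= d.
Proof.
move=> /and3P[_ _ n0] grpE.
have ex i : exists x, grp x == i.
  have : G i != set0 by apply: contraNneq n0 => <-; apply: imset_f.
  by case/set0Pn => x; rewrite grpE; exists x.
have [h hP] := fin_all_exists ex.
have /leq_card : injective h by move=> i j e; rewrite -(eqP (hP i)) e (eqP (hP j)).
by rewrite !card_ord.
Qed.

Theorem theorem2 :
  exists (p : cmd) (C c : nat),
  forall (d g : nat) (pi : 'S_d) (G : 'I_g -> {set 'I_d})
         (alpha beta : 'I_g -> rat) (k b w : nat),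
  injective G ->
  partition [set G i | i : 'I_g] [set: 'I_d] ->
  (forall i, (0 <= alpha i <= 1)%R) ->
  (forall i, (0 <= beta i <= 1)%R) ->
  (0 < k <= d)%N ->
  (0 < b)%N ->
  (forall i, (b%:R * alpha i)%R \is a Num.int) ->
  (forall i, (b%:R * beta i)%R \is a Num.int) ->
  enough_bits c w (encode pi G alpha beta k b) ->
  exists (t : nat) (m : memory),
  [/\ exec w p (load (encode pi G alpha beta k b)) t m,
      (t <= C * d ^ 2)%N,
      (exists tau, block_fair G alpha beta k b tau) ->
        exists2 sigma, closest_block_fair G alpha beta k b pi sigma
                     & outputs m sigma
    & ~ (exists tau, block_fair G alpha beta k b tau) -> reports_none m].
Proof.
exists fair_ranking_cmd, 1000, 6 => d g pi G alpha beta k b w injG part.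
move=> alpha01 beta01 /andP[k_gt0 le_kd] b_gt0 alpha_int beta_int bits.
have a0 i : (0 <= alpha i)%R by case/andP: (alpha01 i).
have b0 i : (0 <= beta i)%R by case/andP: (beta01 i).
have [grp grpE] := group_of injG part; have le_gd := leq_groups part grpE.
set s := encode _ _ _ _ _ _ in bits *.
have le_max r x : r < 7 -> x \in nth [::] s r -> x < (max_entry s).+2.
  by move=> r7 xr; rewrite ltnW // !ltnS (leq_max_entry _ xr) // mem_nth.
have in0 x : x \in [:: d; g; k; b] -> x < (max_entry s).+2 by apply: (le_max 0).
have ltd : d < (max_entry s).+2 by apply: in0; rewrite !inE eqxx.
have ltg : g < (max_entry s).+2 by apply: in0; rewrite !inE eqxx orbT.
have ltb : b < (max_entry s).+2 by apply: in0; rewrite !inE eqxx !orbT.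
(* Since [d >= 1] is itself an input word, the maximum is at least 1. *)
have N_gt2 : 2 < (max_entry s).+2.
  rewrite !ltnS; apply: leq_trans (leq_trans k_gt0 le_kd) _.
  by apply: (leq_max_entry (r := nth [::] s 0)); rewrite ?mem_nth ?inE ?eqxx.
have lt_alpha i : `|numq (alpha i)|%N < (max_entry s).+2.
  by apply: (le_max 3) => //; apply: map_f; rewrite mem_enum.
have lt_beta i : `|numq (beta i)|%N < (max_entry s).+2.
  by apply: (le_max 5) => //; apply: map_f; rewrite mem_enum.
have zero a j : 6 < a -> load s a j = 0.
  by move=> a6; rewrite /load (nth_default _ (s := s)) ?nth_nil.
have fairE := block_fairE k grpE a0 b0 alpha_int beta_int.
have [t [m [ex le_t res]]] := run_fair_ranking (leq_trans k_gt0 le_kd) k_gt0 le_kd b_gt0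
  (fun f m n => threshold_linear (a0 f) (alpha_int f))
  (fun f m n => threshold_linear (b0 f) (beta_int f))
  N_gt2 ltd ltg ltb lt_alpha lt_beta bits le_gd
  (inputs_load pi alpha beta k b grpE) zero.
exists t, m; split=> //.
- move=> [tau /fairE ft]; case: res => [[sigma [[fs min_s] m7 m8]]|[_ []]]; last by exists tau.
  by exists sigma; split=> // [|tau' /fairE]; [apply/fairE | apply: min_s].
- move=> none; case: res => [[sigma [[fs _] _ _]]|[]] //.
  by case: none; exists sigma; apply/fairE.
Qed.
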